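(* For $n\ge2$, the number $D_n$ of derangements on $n$ elements is given by $\alpha_n(\mathbf{b},\mathbf{b})$, that is, $$D_n=\sum_{\pi}2^{\mathbf{bb}(\pi)},$$ where the sum is over all permutations $\pi$ on $n$ elements with no double ascents and starting and ending with a descent.
   Context: A permutation $\pi=\pi_1\cdots\pi_n$ has an ascent (descent) at position $i$, $1\le i\le n-1$, if $\pi_i<\pi_{i+1}$ ($\pi_i>\pi_{i+1}$). A double ascent is an index $i$ with $\pi_i<\pi_{i+1}<\pi_{i+2}$, a double descent an index $i$ with $\pi_i>\pi_{i+1}>\pi_{i+2}$; $\mathbf{bb}(\pi)$ is the number of double descents of $\pi$. Starting (ending) with a descent means $\pi_1>\pi_2$ ($\pi_{n-1}>\pi_n$). The quantity $\alpha_n(\mathbf{b},\mathbf{b})$ is $\sum_\pi \mathrm{Wt}(\pi)$ over $\pi\in\mathfrak{S}_n$ starting and ending with a descent, where $\mathrm{Wt}(\pi)$ is $0$ if $\pi$ has a double ascent and $2^{\mathbf{bb}(\pi)}$ otherwise. A derangement is a permutation with no fixed points. *)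

(* Defs.v *)
From mathcomp Require Import all_boot all_fingroup.

Set Implicit Arguments.
Unset Strict Implicit.
Unset Printing Implicit Defensive.

(* Positions and values are 0-based: a permutation pi_1 ... pi_n is an element
   s of 'S_n, and nth 0 (one_line s) i is pi_(i+1) - 1. Position predicates
   take an arbitrary natural number and are false outside the valid range. *)
Definition one_line (n : nat) (s : 'S_n) : seq nat := [seq val (s i) | i : 'I_n].

Definition ascent (n : nat) (s : 'S_n) (i : nat) : bool :=
  (i.+1 < n) && (nth 0 (one_line s) i < nth 0 (one_line s) i.+1).

Definition descent (n : nat) (s : 'S_n) (i : nat) : bool :=
  (i.+1 < n) && (nth 0 (one_line s) i > nth 0 (one_line s) i.+1).

Definition double_ascent (n : nat) (s : 'S_n) (i : nat) : bool :=
  ascent s i && ascent s i.+1.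

Definition double_descent (n : nat) (s : 'S_n) (i : nat) : bool :=
  descent s i && descent s i.+1.

Definition has_double_ascent (n : nat) (s : 'S_n) : bool :=
  [exists i : 'I_n, double_ascent s i].

Definition bb (n : nat) (s : 'S_n) : nat :=
  #|[set i : 'I_n | double_descent s i]|.

Definition starts_with_descent (n : nat) (s : 'S_n) : bool := descent s 0.

Definition ends_with_descent (n : nat) (s : 'S_n) : bool := descent s n.-2.

Definition Wt (n : nat) (s : 'S_n) : nat :=
  if has_double_ascent s then 0 else 2 ^ bb s.

Definition alpha_bb (n : nat) : nat :=
  \sum_(s : 'S_n | starts_with_descent s && ends_with_descent s) Wt s.

Definition derangement (n : nat) (s : 'S_n) : bool :=
  [forall i : 'I_n, s i != i].

Definition derangements_number (n : nat) : nat :=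
  #|[set s : 'S_n | derangement s]|.

(* Main.v *)
(** Splitting a word at its largest letter m, as u m v, turns weights into
    products. Let A(S) be the total weight of the arrangements of S counted by
    alpha(b,b), and C(S) the total weight of the arrangements w of S for which
    [infinity w] has no double ascent and ends with a descent (double descents
    of [infinity w] being counted). The split gives C(S) = |S|!, and then
      A(S) + A(S - m) = sum over B included in S - m of A(B) |S - m - B|!,
    from which the A(B), for B included in S, sum to |S|! by induction. The
    numbers of permutations with moved set exactly B also sum to |S|!, and such
    sums determine the summands. *)
Require Import Defs.
From mathcomp Require Import all_boot all_fingroup.

Set Implicit Arguments.
Unset Strict Implicit.
Unset Printing Implicit Defensive.

(** * Weights of words split at their largest letter *)

(* The weight of the word x w, or 0 if it has a double ascent or does not end
   with a descent; d tells whether the step leading to x was a descent. *)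
Fixpoint scan (d : bool) (x : nat) (w : seq nat) : nat :=
  if w is y :: w' then
    if y < x then (if d then 2 else 1) * scan true y w'
    else if d then scan false y w' else 0
  else d.

(* For d = true this is the weight of w preceded by an infinite letter, and for
   d = false the weight that w contributes to alpha(b,b); the empty word has
   weight 1 in both cases. *)
Definition word_weight (d : bool) (w : seq nat) : nat :=
  if w is x :: w' then scan d x w' else 1.

(** The step into m is an ascent: the step before it must be a descent, which the first factor
    tests, and the scan goes on from m in the state [false]. *)
Lemma scan_cat_max d x u m v :
  all (ltn^~ m) (x :: u) -> scan d x (u ++ m :: v) = scan d x u * scan false m v.
Proof.
elim: u d x => [|y u IHu] d x /= /andP[xm].
  by rewrite ltnNge (ltnW xm) /=; case: d; rewrite ?mul1n ?mul0n.
move=> uym; case: ifP => _; first by rewrite IHu // mulnA.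
by case: d; rewrite ?mul0n // IHu.
Qed.

Lemma scan_max d m v : all (ltn^~ m) v ->
  scan d m v = if v is [::] then d : nat else d.+1 * word_weight true v.
Proof. by case: v => [|y v] //= /andP[-> _]; case: d. Qed.

(** A descent must follow m, so v is not empty; for v the letter m acts as the infinite one. *)
Lemma word_weight_false_cat_max u m v : all (ltn^~ m) (u ++ v) ->
  word_weight false (u ++ m :: v)
    = word_weight false u * ((v != [::]) * word_weight true v).
Proof.
rewrite all_cat => /andP[um vm].
have Ev : scan false m v = (v != [::]) * word_weight true v.
  by rewrite scan_max //; case: v vm.
case: u um => [|x u] um; first by rewrite /= Ev mul1n.
by rewrite /= scan_cat_max // Ev.
Qed.

(** If u is empty, infinity descends to m: v may be empty, and otherwise a double descent arises
    with factor 2. If u is not empty, m is reached by an ascent and v cannot be empty. *)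
Lemma word_weight_true_cat_max u m v : all (ltn^~ m) (u ++ v) ->
  word_weight true (u ++ m :: v)
    = ((u == [::]) + (v != [::])) * (word_weight true u * word_weight true v).
Proof.
rewrite all_cat => /andP[um vm].
case: u um => [|x u] um; first by rewrite /= scan_max // mul1n; case: v vm.
rewrite /= scan_cat_max // (scan_max _ vm).
by case: v vm => [|y v] _; rewrite ?muln0 ?mul1n.
Qed.

(** * Arrangements of a finite set *)

Lemma mem_permutations_enum (T : finType) (A : {set T}) (w : seq T) :
  (w \in permutations (enum A)) = uniq w && ([set x in w] == A).
Proof.
rewrite mem_permutations; apply/idP/andP => [wA | [Uw /eqP <-]].
  split; first by rewrite (perm_uniq wA) enum_uniq.
  by apply/eqP/setP=> x; rewrite inE (perm_mem wA) mem_enum.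
by apply: uniq_perm; rewrite ?enum_uniq // => x; rewrite mem_enum inE.
Qed.

Lemma nil_permutations_enum (T : finType) (w : seq T) (D : {set T}) :
  w \in permutations (enum D) -> (w == [::]) = (D == set0).
Proof.
rewrite mem_permutations => /perm_size.
by rewrite -cardE -size_eq0 -cards_eq0 => ->.
Qed.

(** An arrangement of A factors at m in one way as u m v. The sum is grouped by the set B of letters
    of u, which [left_of] reads off. *)
Lemma sum_permutations_split (T : finType) (A : {set T}) (m : T)
    (f : seq T -> nat) : m \in A ->
  \sum_(w <- permutations (enum A)) f w
  = \sum_(B in powerset (A :\ m)) \sum_(u <- permutations (enum B))
      \sum_(v <- permutations (enum ((A :\ m) :\: B))) f (u ++ m :: v).
Proof.
move=> mA; pose left_of w : {set T} := [set x in take (index m w) w].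
have splitw w : w \in permutations (enum A) ->
    exists u v, [/\ w = u ++ m :: v, m \notin u & m \notin v].
  rewrite mem_permutations_enum => /andP[Uw /eqP Aw].
  have mw : m \in w by move: mA; rewrite -Aw inE.
  case/splitPr: mw Uw Aw => u v; rewrite cat_uniq /= => /and4P[_].
  by rewrite negb_or => /andP[mu _] mv _ _; exists u, v.
have left_cat u v : m \notin u -> left_of (u ++ m :: v) = [set x in u].
  move=> mu; rewrite /left_of index_cat (negPf mu) /= eqxx addn0.
  by rewrite take_size_cat.
rewrite big_seq_cond (partition_big left_of (mem (powerset (A :\ m)))) /=; last first.
  move=> w; rewrite andbT => wA; have [u [v [Ew mu mv]]] := splitw w wA.
  rewrite Ew left_cat // powersetE; apply/subsetP=> x; rewrite !inE => xu.
  move: wA; rewrite mem_permutations_enum => /andP[_ /eqP <-].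
  by rewrite Ew inE mem_cat xu andbT; apply: contraNneq mu => <-.
apply: eq_bigr => B; rewrite powersetE => BA.
(* The double sum becomes a sum over the list of words u m v; this list and the filtered one are
   duplicate-free with the same members. *)
rewrite -(big_allpairs_dep (h := fun u v => u ++ m :: v) (F := f)).
under eq_bigl => w do rewrite andbT.
rewrite -big_seq_cond -big_filter; apply: perm_big.
have mB : m \notin B by apply/negP => /(subsetP BA); rewrite !inE eqxx.
apply: uniq_perm.
- by rewrite filter_uniq // permutations_uniq.
- apply: allpairs_uniq; rewrite ?permutations_uniq //.
  move=> [u1 v1] [u2 v2] /allpairsP[[u v] /= [uB _ [-> ->]]].
  move=> /allpairsP[[u' v'] /= [u'B _ [-> ->]]] E.
  move: uB u'B; rewrite !mem_permutations_enum.
  move=> /andP[_ /eqP uB] /andP[_ /eqP u'B].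
  have mu : m \notin u by move: mB; rewrite -uB inE.
  have mu' : m \notin u' by move: mB; rewrite -u'B inE.
  have Eu : size u = size u'.
    move: (congr1 (index m) E).
    by rewrite !index_cat (negPf mu) (negPf mu') /= eqxx !addn0.
  by move/eqP: E; rewrite eqseq_cat // eqseq_cons => /and3P[/eqP-> _ /eqP->].
move=> w; rewrite mem_filter; apply/andP/allpairsP => [[/eqP lw wA] | ].
  have [u [v [Ew mu mv]]] := splitw w wA; exists (u, v); split=> //=.
    move: lw wA; rewrite Ew left_cat // !mem_permutations_enum => ->.
    by rewrite cat_uniq => /andP[/and3P[-> _ _] _] /=.
  move: lw wA; rewrite Ew left_cat // !mem_permutations_enum => <-.
  rewrite cat_uniq => /andP[/= /and4P[_ ]].
  rewrite negb_or => /andP[_ uv] _ -> /eqP<- /=.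
  apply/eqP/setP=> x; rewrite !inE mem_cat inE.
  case: (eqVneq x m) => [->|_]; first by rewrite (negPf mv) andbF.
  have := hasPn uv x; case: (x \in v) => [->|]; rewrite //= ?orbT //.
  by case: (x \in u).
case=> [[u v] /= []]; rewrite !mem_permutations_enum.
move=> /andP[Uu /eqP uB] /andP[Uv /eqP vB] ->.
have mu : m \notin u by move: mB; rewrite -uB inE.
have mv : m \notin v by move/setP/(_ m): vB; rewrite !inE eqxx andbF => ->.
rewrite left_cat // uB eqxx cat_uniq Uu /= negb_or mu mv Uv /= andbT; split=> //.
apply/andP; split.
  by apply/hasPn => x xv; move/setP/(_ x): vB; rewrite -uB !inE xv => /esym/andP[].
apply/eqP/setP=> x; rewrite inE mem_cat inE.
case: (eqVneq x m) => [->|xm]; first by rewrite mA orbT.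
move/setP/(_ x): vB; rewrite !inE xm /= => ->.
move/setP/(_ x): uB; rewrite !inE => ->.
case xB: (x \in B) => //=.
by move/subsetP/(_ x xB): BA; rewrite !inE => /andP[].
Qed.

(** * Sums over subsets *)

Lemma sum_powerset_card (T : finType) (A : {set T}) (F : nat -> nat) :
  \sum_(B in powerset A) F #|B| = \sum_(k < #|A|.+1) 'C(#|A|, k) * F k.
Proof.
pose c (B : {set T}) : 'I_#|A|.+1 := inord #|B|.
rewrite (partition_big c predT) //=; apply: eq_bigr => k _.
rewrite -cards_draws -sum_nat_const; apply: eq_big => [B|B /andP[BA /eqP <-]].
  rewrite !inE; apply: andb_id2l => BA.
  by rewrite -val_eqE /= inordK // ltnS subset_leq_card.
by rewrite inordK // ltnS subset_leq_card -?powersetE.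
Qed.

(** The subsets of any one size contribute |A|! together, and there are |A| + 1 sizes. *)
Lemma sum_powerset_fact (T : finType) (A : {set T}) :
  \sum_(B in powerset A) #|B|`! * #|A :\: B|`! = (#|A|.+1)`!.
Proof.
transitivity (\sum_(B in powerset A) #|B|`! * (#|A| - #|B|)`!).
  by apply: eq_bigr => B; rewrite powersetE => BA; rewrite cardsDS.
rewrite (sum_powerset_card _ (fun k => k`! * (#|A| - k)`!)).
under eq_bigr => k _ do rewrite bin_fact ?leq_ord //.
by rewrite sum_nat_const card_ord factS.
Qed.

Lemma sum_powersetD1 (T : finType) (A : {set T}) (m : T) (F : {set T} -> nat) :
    m \in A ->
  \sum_(B in powerset A) F B = \sum_(B in powerset (A :\ m)) (F (m |: B) + F B).
Proof.
move=> mA; rewrite big_split /= (bigID (fun B : {set T} => m \in B)) /=.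
congr addn; last by apply: eq_bigl => B; rewrite !powersetE subsetD1.
rewrite (reindex_onto (fun B => m |: B) (fun B => B :\ m)) /=; last first.
  by move=> B /andP[_ mB]; rewrite setD1K.
apply: eq_bigl => B; rewrite !powersetE subUset sub1set mA setU11 andbT /=.
rewrite subsetD1; apply: andb_id2l => BA.
apply/eqP/idP => [<-|mB]; first by rewrite !inE eqxx.
by rewrite setU1K.
Qed.

(** Induction on |A|: the terms of the proper subsets cancel. *)
Lemma sum_powerset_inj (T : finType) (F G : {set T} -> nat) :
    (forall A, \sum_(B in powerset A) F B = \sum_(B in powerset A) G B) ->
  F =1 G.
Proof.
move=> FG A; have [k] := ubnP #|A|; elim: k A => // k IHk A; rewrite ltnS => Ak.
have := FG A; rewrite (bigD1 A) ?powersetE //= [RHS](bigD1 A) ?powersetE //=.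
rewrite [X in _ + X = _ -> _](eq_bigr G) => [/addIn //|B].
rewrite powersetE andbC -properEneq => /proper_card BA; apply: IHk.
exact: leq_trans BA Ak.
Qed.

(** * Total weights of the arrangements of a set *)

Section WeightOfSets.

Variable n : nat.
Implicit Types (A B C : {set 'I_n}) (m : 'I_n).

(** For [d = true] this is the total called C in the outline above, for [d = false] the one called
    A. *)
Definition set_weight d A : nat :=
  \sum_(w <- permutations (enum A)) word_weight d (map val w).

Lemma set_weight0 d : set_weight d set0 = 1.
Proof. by rewrite /set_weight enum_set0 big_seq1. Qed.

Lemma permutations_split_lt A m B u v :
    m \in A -> {in A, forall x : 'I_n, x <= m} -> B \in powerset (A :\ m) ->
    u \in permutations (enum B) -> v \in permutations (enum ((A :\ m) :\: B)) ->
  all (ltn^~ (val m)) (map val u ++ map val v).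
Proof.
move=> mA Am; rewrite powersetE => /subsetP BA.
rewrite !mem_permutations_enum => /andP[_ /eqP uB] /andP[_ /eqP vB].
have ltm x : x \in A :\ m -> x < m.
  by rewrite !inE => /andP[xm xA]; rewrite ltn_neqAle Am // andbT.
rewrite -map_cat all_map; apply/allP=> x; rewrite mem_cat => /orP[xu|xv] /=.
  by apply/ltm/BA; rewrite -uB inE.
by apply: ltm; move/setP/(_ x): vB; rewrite inE xv inE => /esym/andP[].
Qed.

(** [phi] is where the two word splittings differ. It sees only whether u and v are empty, that is,
    whether B is empty or all of [A :\ m]. *)
Lemma set_weight_split (phi : bool -> bool -> nat) d A m :
    m \in A -> {in A, forall x : 'I_n, x <= m} ->
    (forall u v, all (ltn^~ (val m)) (u ++ v) ->
       word_weight d (u ++ val m :: v)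
       = phi (u == [::]) (v == [::]) * (word_weight d u * word_weight true v)) ->
  set_weight d A = \sum_(B in powerset (A :\ m)) phi (B == set0) (B == A :\ m)
                     * (set_weight d B * set_weight true ((A :\ m) :\: B)).
Proof.
move=> mA Am Ephi; rewrite /set_weight (sum_permutations_split _ mA).
apply: eq_bigr => B BA; rewrite big_distrl big_distrr /=.
rewrite big_seq [RHS]big_seq; apply: eq_bigr => u uB.
rewrite big_distrr big_distrr /= big_seq [RHS]big_seq; apply: eq_bigr => v vB.
rewrite map_cat /= Ephi ?(permutations_split_lt mA Am BA uB vB) //.
have mapnil (w : seq 'I_n) : (map val w == [::]) = (w == [::]) by case: w.
rewrite !mapnil (nil_permutations_enum uB) (nil_permutations_enum vB).
by move: BA; rewrite setD_eq0 (eqEsubset B (A :\ m)) powersetE => ->.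
Qed.

Lemma set_max A : A != set0 ->
  exists2 m, m \in A & {in A, forall x : 'I_n, x <= m}.
Proof.
case/set0Pn=> i0 Ai0; case: (arg_maxnP (fun i : 'I_n => i : nat) Ai0) => m mA Am.
by exists m.
Qed.

Lemma set_weight_true A : set_weight true A = #|A|`!.
Proof.
have [k] := ubnP #|A|; elim: k A => // k IHk A; rewrite ltnS => Ak.
have [->|/set_max[m mA Am]] := eqVneq A set0; first by rewrite set_weight0 cards0.
pose phi (a b : bool) := a + ~~ b.
rewrite (set_weight_split (phi := phi) mA Am); last first.
  by move=> u v /word_weight_true_cat_max ->.
have cA : #|A| = #|A :\ m|.+1 by rewrite (cardsD1 m A) mA.
rewrite cA -sum_powerset_fact.
rewrite (eq_bigr (fun B => (B == set0) * (#|B|`! * #|A :\ m :\: B|`!)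
                   + (B != A :\ m) * (#|B|`! * #|A :\ m :\: B|`!))); last first.
  move=> B; rewrite powersetE => BA; rewrite -mulnDl !IHk //.
    by rewrite (leq_trans _ Ak) // cA ltnS subset_leq_card // subsetDl.
  by rewrite (leq_trans _ Ak) // cA ltnS subset_leq_card.
(* The terms of B = set0 and of B = A :\ m are equal, so the first, counted
   twice, makes up for the second, which is missing. *)
rewrite big_split /= (bigD1 set0) ?powersetE ?sub0set //= eqxx mul1n.
rewrite big1 ?addn0 => [|B /andP[_ /negPf->]] //.
rewrite [RHS](bigD1 (A :\ m)) ?powersetE //= [in RHS]setDv setD0 cards0 mulnC.
congr addn; rewrite (bigD1 (A :\ m)) ?powersetE //= eqxx mul0n add0n.
by apply: eq_bigr => B /andP[_ ->]; rewrite mul1n.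
Qed.

(** The split lacks the term of B = [A :\ m], where v is empty; the second summand on the left
    restores it, with factor 0! = 1. *)
Lemma set_weight_false_split A m :
    m \in A -> {in A, forall x : 'I_n, x <= m} ->
  set_weight false A + set_weight false (A :\ m)
  = \sum_(B in powerset (A :\ m)) set_weight false B * #|A :\ m :\: B|`!.
Proof.
move=> mA Am; rewrite (set_weight_split (phi := fun _ b => ~~ b) mA Am); last first.
  by move=> u v /word_weight_false_cat_max ->; rewrite mulnCA.
rewrite (bigD1 (A :\ m)) ?powersetE //= eqxx mul0n add0n.
rewrite [RHS](bigD1 (A :\ m)) ?powersetE //= setDv cards0 muln1 addnC.
congr addn; apply: eq_bigr => B /andP[_ ->].
by rewrite mul1n set_weight_true.
Qed.

(** Pairing B with [m |: B] makes the split applicable. After an exchange of sums, induction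
    evaluates the inner one and [sum_powerset_fact] the outer one. *)
Lemma sum_set_weight_false A :
  \sum_(B in powerset A) set_weight false B = #|A|`!.
Proof.
have [k] := ubnP #|A|; elim: k A => // k IHk A; rewrite ltnS => Ak.
have [->|/set_max[m mA Am]] := eqVneq A set0.
  by rewrite powerset0 big_set1 set_weight0 cards0.
have cA : #|A| = #|A :\ m|.+1 by rewrite (cardsD1 m A) mA.
rewrite (sum_powersetD1 _ mA) cA -sum_powerset_fact.
transitivity (\sum_(B in powerset (A :\ m)) \sum_(C in powerset B)
                set_weight false (B :\: C) * #|C|`!).
  apply: eq_bigr => B; rewrite powersetE => /subsetP BA.
  have mB : m \notin B by apply/negP => /BA; rewrite !inE eqxx.
  have := @set_weight_false_split (m |: B) m; rewrite setU1K // => ->.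
  (* C now denotes the complement of the left part, so that the factorial depends on C alone. *)
  - rewrite (reindex_onto (fun C => B :\: C) (fun C => B :\: C)) /=; last first.
      by move=> C; rewrite powersetE setDDr setDv set0U => /setIidPr.
    apply: eq_big => [C|C].
      rewrite !powersetE subsetDl setDDr setDv set0U /=.
      by apply/eqP/idP => [<-|/setIidPr //]; exact: subsetIl.
    by rewrite powersetE setDDr setDv set0U => /andP[_ /eqP->].
  - by rewrite setU11.
  - by move=> x; rewrite !inE => /predU1P[->|/BA] //; rewrite !inE => /andP[_ /Am].
(* For fixed C, the sets B :\: C range over the subsets of A :\ m :\: C. *)
rewrite (exchange_big_dep (mem (powerset (A :\ m)))) /=; last first.
  by move=> B C; rewrite !powersetE => BA /subset_trans ->.
apply: eq_bigr => C; rewrite powersetE => CA; rewrite -big_distrl mulnC /=.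
congr muln; rewrite -IHk; last first.
  by rewrite (leq_trans _ Ak) // cA ltnS subset_leq_card // subsetDl.
rewrite (reindex_onto (fun B => C :|: B) (fun B => B :\: C)) /=; last first.
  by move=> B /andP[_]; rewrite powersetE => CB; rewrite -{1}(setIidPr CB) setID.
apply: eq_big => [B|B].
  rewrite !powersetE subsetUl andbT subUset CA /= (subsetD B (A :\ m)).
  apply: andb_id2l => BA.
  by rewrite setDUl setDv set0U; apply/eqP/idP => [/setDidPl|/setDidPl].
by move=> /andP[_ /eqP->].
Qed.

End WeightOfSets.

(** * Permutations classified by their moved points *)

Definition moved (T : finType) (s : {perm T}) : {set T} := [set x | s x != x].

(** The permutations that move only points of A are those counted by [card_perm]. *)
Lemma sum_moved (T : finType) (A : {set T}) :
  \sum_(B in powerset A) #|[set s : {perm T} | moved s == B]| = #|A|`!.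
Proof.
rewrite -card_perm -[RHS]sum1_card.
rewrite (partition_big (@moved T) (mem (powerset A))) /=; last first.
  move=> s /subsetP sA; rewrite powersetE; apply/subsetP=> x.
  by rewrite inE; apply: sA.
apply: eq_bigr => B; rewrite powersetE => BA; rewrite -sum1_card.
apply: eq_bigl => s; rewrite !inE andbC.
case: eqP => //= sB; symmetry; apply/subsetP=> x sx.
by apply: (subsetP BA); rewrite -sB inE.
Qed.

Lemma derangements_numberE n :
  derangements_number n = set_weight false [set: 'I_n].
Proof.
rewrite -(@sum_powerset_inj _ (fun B => #|[set s : 'S_n | moved s == B]|)).
  apply: eq_card => s; rewrite !inE; apply/forallP/eqP => [sd|sT i].
    by apply/setP=> i; rewrite !inE sd.
  by move/setP/(_ i): sT; rewrite !inE.
by move=> A; rewrite sum_moved sum_set_weight_false.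
Qed.

(** * From weights of words to weights of permutations *)

(** The permutations give n! distinct arrangements, so counting shows that no arrangement is
    missed. *)
Lemma sum_permutations_setT n (f : seq nat -> nat) :
  \sum_(w <- permutations (enum [set: 'I_n])) f (map val w)
  = \sum_(s : 'S_n) f (one_line s).
Proof.
pose word (s : 'S_n) := [seq s i | i <- enum 'I_n].
have word_inj : injective word.
  by move=> s t /eq_in_map E; apply/permP=> i; apply: E; rewrite mem_enum.
have Uword : uniq (map word (enum 'S_n)) by rewrite map_inj_uniq ?enum_uniq.
have sub : {subset map word (enum 'S_n) <= permutations (enum [set: 'I_n])}.
  move=> _ /mapP[s _ ->]; rewrite mem_permutations_enum.
  rewrite map_inj_uniq ?enum_uniq //=; last exact: perm_inj.
  apply/eqP/setP=> i; rewrite !inE; apply/mapP; exists (s^-1%g i).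
    by rewrite mem_enum.
  by rewrite permKV.
have [|_ Eword] := uniq_min_size Uword sub.
  rewrite size_permutations ?enum_uniq // size_map -!cardE.
  by rewrite cardsT card_ord card_Sn.
rewrite -(perm_big _ (uniq_perm Uword (permutations_uniq _) Eword)) /=.
rewrite big_map big_enum /=; apply: eq_bigr => s _.
by rewrite /word -map_comp.
Qed.

(** The position predicates are restated for words, as induction passes to tails that need not come
    from permutations. *)
Definition seq_ascent (w : seq nat) (i : nat) : bool :=
  (i.+1 < size w) && (nth 0 w i < nth 0 w i.+1).

Definition seq_descent (w : seq nat) (i : nat) : bool :=
  (i.+1 < size w) && (nth 0 w i > nth 0 w i.+1).

Definition seq_double_ascent (w : seq nat) (i : nat) : bool :=
  seq_ascent w i && seq_ascent w i.+1.

Definition seq_double_descent (w : seq nat) (i : nat) : bool :=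
  seq_descent w i && seq_descent w i.+1.

(** [scan] treats a step between equal letters as an ascent, unlike [seq_ascent]; [uniq] excludes
    such steps. Each d on the right stands for the step leading to x. *)
Lemma scanE d x w (W := x :: w) : uniq W ->
  scan d x w =
    if [&& ~~ has (seq_double_ascent W) (iota 0 (size W)),
           d || ~~ seq_ascent W 0
         & if w is [::] then d else seq_descent W (size w).-1]
    then 2 ^ (count (seq_double_descent W) (iota 0 (size W))
                + (d && seq_descent W 0))
    else 0.
Proof.
rewrite {}/W; elim: w d x => [|y w IHw] d x; first by case: d.
rewrite cons_uniq inE negb_or => /andP[/andP[xy _] Uyw].
have -> : iota 0 (size (x :: y :: w)) = 0 :: map S (iota 0 (size (y :: w))).
  by rewrite [LHS]/= -[1]/(1 + 0) -(iotaDl 1 0 (size (y :: w))).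
(* The recursive call has d equal to [y < x], so its ending condition is that of the whole word even
   when w is empty. *)
have E : (if w is [::] then y < x else seq_descent (y :: w) (size w).-1)
         = seq_descent (x :: y :: w) (size w) by case: (w).
have A0 : seq_ascent (x :: y :: w) 0 = (x < y) by [].
have D0 : seq_descent (x :: y :: w) 0 = (y < x) by [].
have A1 : seq_double_ascent (x :: y :: w) 0 = (x < y) && seq_ascent (y :: w) 0.
  by [].
have D1 : seq_double_descent (x :: y :: w) 0 = (y < x) && seq_descent (y :: w) 0.
  by [].
have has0S (P : pred nat) r : has P (0 :: map S r) = P 0 || has (P \o S) r.
  by rewrite /= has_map.
have count0S (P : pred nat) r : count P (0 :: map S r) = P 0 + count (P \o S) r.
  by rewrite /= count_map.
rewrite [LHS]/= !IHw // has0S count0S A0 D0 A1 D1 -E.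
set h := has _ (iota 0 _); set c := count _ (iota 0 _).
set a := seq_ascent _ 0; set b := seq_descent _ 0.
case: ltngtP xy => // _ _ /=.
  rewrite negb_or orbT andbT /=.
  case: d; case: ifP => _; rewrite ?muln0 ?mul1n ?addn0 //.
    by rewrite -expnS addn1 (addnC b).
  by rewrite (addnC b).
case: d => //=; rewrite ?andbF //.
by rewrite addn0; case: a; case: h.
Qed.

Lemma word_weight_one_line n (s : 'S_n) : 1 < n ->
  word_weight false (one_line s)
  = if starts_with_descent s && ends_with_descent s then Wt s else 0.
Proof.
move=> n1; have size_s : size (one_line s) = n by rewrite size_map -cardE card_ord.
have Us : uniq (one_line s).
  by rewrite map_inj_uniq ?enum_uniq // => i j /val_inj/perm_inj.
have has_ord (P : pred nat) : has P (iota 0 n) = [exists i : 'I_n, P i].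
  rewrite -val_enum_ord has_map.
  apply/hasP/existsP => [[i _]|[i Pi]]; first by exists i.
  by exists i; rewrite ?mem_enum.
have count_ord (P : pred nat) : count P (iota 0 n) = #|[set i : 'I_n | P i]|.
  by rewrite -val_enum_ord count_map cardsE cardE size_filter -enumT.
have -> : Wt s = if ~~ has (seq_double_ascent (one_line s)) (iota 0 n)
                 then 2 ^ count (seq_double_descent (one_line s)) (iota 0 n) else 0.
  rewrite has_ord count_ord /seq_double_ascent /seq_double_descent.
  by rewrite /seq_ascent /seq_descent size_s if_neg.
have -> : starts_with_descent s = seq_descent (one_line s) 0.
  by rewrite /seq_descent size_s.
have -> : ends_with_descent s = seq_descent (one_line s) n.-2.
  by rewrite /seq_descent size_s.
case: (one_line s) size_s Us => [|x [|y w]] size_s Us; rewrite -size_s // in n1 *.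
(* As the letters are distinct, the condition of [scan false] on the first step says that it is a
   descent. *)
have a0 : ~~ seq_ascent [:: x, y & w] 0 = seq_descent [:: x, y & w] 0.
  move: Us => /= /andP[]; rewrite inE negb_or => /andP[xy _] _.
  by rewrite /seq_ascent /seq_descent /=; case: ltngtP xy.
rewrite -[LHS]/(scan false x (y :: w)) scanE // orFb a0 andFb addn0.
rewrite -[(size (y :: w)).-1]/(size [:: x, y & w]).-2.
by case: has; rewrite /= ?if_same.
Qed.

Theorem corollary6p5 (n : nat) (hn : 2 <= n) :
  derangements_number n = alpha_bb n /\
  derangements_number n =
    \sum_(s : 'S_n | [&& ~~ has_double_ascent s, starts_with_descent s
                       & ends_with_descent s]) 2 ^ bb s.
Proof.
have D : derangements_number n = alpha_bb n.
  rewrite derangements_numberE [LHS](sum_permutations_setT _ (word_weight false)).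
  rewrite /alpha_bb [RHS]big_mkcond /=; apply: eq_bigr => s _.
  exact: word_weight_one_line.
split; rewrite D // /alpha_bb big_mkcond [RHS]big_mkcond /=.
by apply: eq_bigr => s _; rewrite /Wt; case: has_double_ascent; case: ifP.
Qed.
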